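(* Let $f:\mathbb{R}^n\to\mathbb{R}$ be twice continuously differentiable and let $\{x_k\}$ be generated by the MINRES-based linesearch method described in the context. Suppose that the regularization parameters satisfy $\zeta_k=\min\{\mathsf Z, z_k\|g_k\|^{\zeta}\}$ for all $k$, with $\mathsf Z>0$, $\zeta\in(0,1]$, $z_k\ge\bar z>0$. Suppose in addition that at least one of the following holds: (a) there is $M>0$ such that $\|B_k\|\le M$ for all $k\in\mathbb{N}$, and the tolerances satisfy $\theta_k=\min\{\mathsf B, b_k\|g_k\|^{\beta}\}$ for all $k$, with $\mathsf B,\beta>0$ and $b_k\ge\bar b>0$; or (b) $B_k=\nabla^2 f(x_k)$ for all $k\in\mathbb{N}$. Then every accumulation point of $\{x_k\}$ is a stationary point of $f$, i.e., a point $x^*$ with $\nabla f(x^* )=0$.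
   Context: Notation: $\|\cdot\|$ is the Euclidean norm for vectors and the spectral norm for matrices; $\mathbb S_n$ is the set of symmetric real $n\times n$ matrices; $g_k:=\nabla f(x_k)$. MINRES routine (exact arithmetic). Given $A\in\mathbb S_n$, $b\in\mathbb{R}^n\setminus\{0\}$ and a tolerance $\theta\ge 0$, let $\mathcal K_t(A,b)=\mathrm{span}\{b,Ab,\dots,A^{t-1}b\}$, $p_0=0$, $p_t=\mathrm{argmin}_{p\in\mathcal K_t(A,b)}\|b-Ap\|$ and $r_t=b-Ap_t$. $\mathrm{MINRES}(A,b,\theta)$ performs, for $t=1,2,\dots$: (1) if $r_{t-1}^\top A r_{t-1}\le 0$ (non-positive curvature is detected), stop and return $d=\|b\|\, r_{t-1}/\|r_{t-1}\|$ with flag NPC; (2) otherwise compute $p_t$; if $\|r_t\|\le\theta\|b\|$, stop and return $d=p_t$ with flag SOL; otherwise continue with $t+1$. MINRES-based linesearch method. Input: $x_0\in\mathbb{R}^n$, $\rho,\sigma\in(0,1)$, $\alpha\in(0,1]$, $\mathsf A\in(0,1]$, $s>0$, tolerances $\theta_k\ge0$, parameters $a_k\ge\bar a>0$, and $\zeta_k\ge 0$. For $k=0,1,\dots$: set $g_k=\nabla f(x_k)$, choose $B_k\in\mathbb S_n$ (an approximation of $\nabla^2 f(x_k)$), and set $\bar B_k=B_k+\zeta_k I$. If $g_k=0$, stop. Otherwise compute $(d_k,\mathrm{flag}_k)$ by $\mathrm{MINRES}(\bar B_k,-g_k,\theta_k)$. If $\mathrm{flag}_k=\mathrm{SOL}$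 and $d_k^\top\bar B_kd_k<\min\{\mathsf A,a_k\|g_k\|^{\alpha}\}\|d_k\|^2$, then reset $d_k=-g_k$ and $\mathrm{flag}_k=\mathrm{GD}$. Determine the step size $\lambda_k$ as follows and set $x_{k+1}=x_k+\lambda_kd_k$: - If $\mathrm{flag}_k\in\{\mathrm{SOL},\mathrm{GD}\}$: $\lambda_k=s\rho^j$ with $j\ge0$ the smallest integer such that $f(x_k+\lambda_kd_k)-f(x_k)\le\sigma\lambda_kd_k^\top g_k$. - If $\mathrm{flag}_k=\mathrm{NPC}$: consider the condition $(\ast)$ $f(x_k+\lambda d_k)-f(x_k)\le\sigma\lambda g_k^\top d_k+\frac{\sigma}{2}\lambda^2d_k^\top B_kd_k$. If $(\ast)$ fails for $\lambda=s$, then $\lambda_k=s\rho^j$ with $j$ the smallest positive integer such that $(\ast)$ holds for $\lambda = s\rho^j$. If $(\ast)$ holds for $\lambda=s$, then $\lambda_k=s\rho^{-j}$ with $j\ge0$ the largest integer such that $(\ast)$ holds for all $\lambda=s,s\rho^{-1},\dots,s\rho^{-j}$ (forward linesearch). Whenever the method is said to generate $\{x_k\}$, it is implicitly assumed that each forward linesearch stops after finitely many steps. *)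

(* Defs.v *)
(* The library norm and topology on 'cV[R]_n are those of the max norm; the
   Euclidean norm is [enorm] below. *)
From HB Require Import structures.
From mathcomp Require Import all_boot all_order all_algebra.
From mathcomp Require Import all_classical all_reals all_analysis.
Set Implicit Arguments.
Unset Strict Implicit.
Unset Printing Implicit Defensive.
Import Order.TTheory GRing.Theory Num.Theory.
Import numFieldNormedType.Exports.
Local Open Scope classical_set_scope.
Local Open Scope ring_scope.

Section EuclideanSpace.
Context {R : realType} {n : nat}.
Implicit Types (u v x : 'cV[R]_n) (A : 'M[R]_n) (f : 'cV[R]_n -> R).

Definition dot u v : R := (u^T *m v) 0 0.

Definition enorm u : R := Num.sqrt (dot u u).

Definition spectral_norm A : R :=
  sup [set enorm (A *m u) | u in [set u | enorm u <= 1]].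

Definition basis_vec (i : 'I_n) : 'cV[R]_n := delta_mx i 0.

Definition gradient f x : 'cV[R]_n := \col_i 'D_(basis_vec i) f x.

Definition hessian f x : 'M[R]_n :=
  \matrix_(i, j) 'D_(basis_vec j) (fun y => 'D_(basis_vec i) f y) x.

(* [derive] has a default value where the derivative does not exist, so
   differentiability is required explicitly at both orders. *)
Definition twice_continuously_differentiable f : Prop :=
  [/\ forall x, differentiable f x,
      forall x, differentiable (gradient f) x
    & continuous (hessian f)].

End EuclideanSpace.

Section Minres.
Context {R : realType} {n : nat}.
Implicit Types (A : 'M[R]_n) (b d p : 'cV[R]_n) (theta : R).

Definition krylov A b t : {vspace 'cV[R]_n} :=
  <<[seq (A ^+ i) *m b | i <- iota 0 t]>>%VS.

Definition is_minres_iterate A b t p : Prop :=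
  p \in krylov A b t /\
  forall q, q \in krylov A b t -> enorm (b - A *m p) <= enorm (b - A *m q).

(* GD is never returned by MINRES itself; it marks a reset to the negative
   gradient in the linesearch method. *)
Inductive flag := SOL | NPC | GD.

(* [minres A b theta d fl]: MINRES stops with output (d, fl).  Iterations are
   counted from 0, so iteration t tests the curvature along r_t and then
   computes p_(t+1).  If A is singular the minimizer over a Krylov space may
   fail to be unique, in which case any choice of minimizers is allowed; the
   residuals do not depend on it. *)
Definition minres A b theta d (fl : flag) : Prop :=
  exists p : nat -> 'cV[R]_n,
    let r t := b - A *m p t in
    let npc t := dot (r t) (A *m r t) <= 0 in
    let solved t := enorm (r t) <= theta * enorm b in
    [/\ p 0%N = 0,
        forall t, (0 < t)%N -> is_minres_iterate A b t (p t)
      & exists2 t : nat,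
          forall i, (i < t)%N -> ~ npc i /\ ~ solved i.+1
        & [/\ npc t, d = (enorm b / enorm (r t)) *: r t & fl = NPC] \/
          [/\ ~ npc t, solved t.+1, d = p t.+1 & fl = SOL]].

End Minres.

Section LinesearchMethod.
Context {R : realType} {n : nat}.
Implicit Types (f : 'cV[R]_n -> R) (x d : 'cV[R]_n) (B : 'M[R]_n).

(* [Acap] is the constant called A in sans serif in the input of the method. *)
Definition search_direction f (alpha Acap theta a zeta : R) B x d (fl : flag)
    : Prop :=
  let g := gradient f x in
  let Bbar := B + zeta%:M in
  exists d0 fl0, minres Bbar (- g) theta d0 fl0 /\
    let reset := fl0 = SOL /\
      dot d0 (Bbar *m d0) <
        Num.min Acap (a * enorm g `^ alpha) * enorm d0 ^+ 2 in
    (reset /\ d = - g /\ fl = GD) \/ (~ reset /\ d = d0 /\ fl = fl0).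

Definition armijo f (sigma : R) x d (lambda : R) : Prop :=
  f (x + lambda *: d) - f x <= sigma * lambda * dot d (gradient f x).

Definition npc_decrease f (sigma : R) B x d (lambda : R) : Prop :=
  f (x + lambda *: d) - f x <=
    sigma * lambda * dot (gradient f x) d
    + sigma / 2 * lambda ^+ 2 * dot d (B *m d).

Definition backtracking (s rho : R) (P : R -> Prop) (lambda : R) : Prop :=
  exists j : nat,
    [/\ lambda = s * rho ^+ j, P (s * rho ^+ j)
      & forall i, P (s * rho ^+ i) -> (j <= i)%N].

Definition npc_linesearch (s rho : R) (P : R -> Prop) (lambda : R) : Prop :=
  (~ P s -> exists j : nat,
      [/\ (0 < j)%N, lambda = s * rho ^+ j, P (s * rho ^+ j)
        & forall i, (0 < i)%N -> P (s * rho ^+ i) -> (j <= i)%N]) /\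
  (P s -> exists j : nat,
      [/\ lambda = s * rho ^- j,
          forall i, (i <= j)%N -> P (s * rho ^- i)
        & forall j', (forall i, (i <= j')%N -> P (s * rho ^- i)) ->
            (j' <= j)%N]).

Definition step_size f (s rho sigma : R) B x d (fl : flag) (lambda : R)
    : Prop :=
  match fl with
  | SOL | GD => backtracking s rho (armijo f sigma x d) lambda
  | NPC => npc_linesearch s rho (npc_decrease f sigma B x d) lambda
  end.

(* [x] is generated by the method with the data B_k, theta_k, a_k, zeta_k.  In
   particular every linesearch carried out is finite.  When the method stops at
   some x_k (that is, g_k = 0), the finite list of iterates is continued by
   repeating x_k. *)
Definition minres_linesearch f (rho sigma alpha Acap s : R)
    (theta a zeta : nat -> R) (B : nat -> 'M[R]_n) (x : nat -> 'cV[R]_n)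
    : Prop :=
  forall k : nat,
    (gradient f (x k) = 0 -> x k.+1 = x k) /\
    (gradient f (x k) <> 0 ->
      exists d fl lambda,
        [/\ search_direction f alpha Acap (theta k) (a k) (zeta k) (B k)
              (x k) d fl,
            step_size f s rho sigma (B k) (x k) d fl lambda
          & x k.+1 = x k + lambda *: d]).

End LinesearchMethod.

(* Main.v *)
Require Import Defs.
From HB Require Import structures.
From mathcomp Require Import all_boot all_order all_algebra.
From mathcomp Require Import all_classical all_reals all_analysis.
From mathcomp Require Import ring lra.
Set Implicit Arguments.
Unset Strict Implicit.
Unset Printing Implicit Defensive.
Import Order.TTheory GRing.Theory Num.Theory.
Import numFieldNormedType.Exports.
Local Open Scope classical_set_scope.
Local Open Scope ring_scope.

(** Suppose that an accumulation point [xstar] has a nonzero gradient.  The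
    values [f (x k)] never increase, so it suffices to find [eta > 0] such
    that every step starting near [xstar] lowers [f] by at least [eta]: one
    such step, taken from a point where [f] is below [f xstar + eta / 2],
    brings [f] below [f xstar - eta / 2] for good, whereas the iterates come
    back arbitrarily near to [xstar] ([cluster_progress_contradiction]).

    Near [xstar] the gradient is bounded above and away from zero, the
    matrices B and the shifts zeta are bounded, and zeta is bounded away from
    zero.  A linesearch accepts a step of at least min(s, rho t0) as soon as
    its condition holds on (0, t0] ([step_sizeP]), so the decrease is uniform
    once the directions are uniformly good.  There are three kinds.

    - Flag SOL.  As long as MINRES meets positive curvature, its residuals
      r_0, ..., r_(t-1) are A-conjugate, hence a basis of the Krylov space,
      and orthogonality of r_t to A K_t gives the coordinates of p_t in it:
      they are (|r_i|^2 - |r_t|^2) / (r_i . A r_i), which are nonnegative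
      ([iterate_conic]).  Consequently p_t . b >= p_t . A p_t, and p_t . b is
      at least a multiple of |b|^2 that depends only on a bound for A and on
      the curvature of A along p_t ([dot_rhs_ge]), which the curvature test of
      the method bounds from below.  Thus the slope along d is at most
      - c |d|^2 and at most a negative constant, and a quadratic upper model
      of f does the rest ([descent_progress]).

    - Flag GD.  The direction - g satisfies the same estimates.

    - Flag NPC.  The direction has length |g|, slope - |g| |r_t|, and
      curvature of B at most - zeta |d|^2.  In case (a) the tolerance keeps
      |r_t| above a multiple of |g|, so the slope alone provides the decrease
      ([npc_progress_tolerance]).  In case (b) the slope may be arbitrarily
      small, but d . B d is the true second-order term of f, and the
      second-order Taylor bound with error below (1 - sigma) zeta |d|^2 / 2
      makes the negative curvature provide the decrease
      ([npc_progress_hessian]). *)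

(** * Euclidean inner product and norm *)

Section EuclideanNorm.
Context {R : realType} {n : nat}.
Implicit Types (u v w : 'cV[R]_n) (A : 'M[R]_n) (c : R).

Lemma dotE u v : dot u v = \sum_i u i 0 * v i 0.
Proof. by rewrite /dot mxE; apply: eq_bigr => i _; rewrite mxE. Qed.

Lemma dotC u v : dot u v = dot v u.
Proof. by rewrite !dotE; apply: eq_bigr => i _; rewrite mulrC. Qed.

Lemma dotDl u v w : dot (u + v) w = dot u w + dot v w.
Proof. by rewrite /dot linearD mulmxDl mxE. Qed.

Lemma dotZl c u v : dot (c *: u) v = c * dot u v.
Proof. by rewrite /dot linearZ -scalemxAl mxE. Qed.

Lemma dotDr u v w : dot u (v + w) = dot u v + dot u w.
Proof. by rewrite dotC dotDl !(dotC u). Qed.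

Lemma dotZr c u v : dot u (c *: v) = c * dot u v.
Proof. by rewrite dotC dotZl dotC. Qed.

Lemma dot0l u : dot 0 u = 0.
Proof. by rewrite /dot trmx0 mul0mx mxE. Qed.

Lemma dot0r u : dot u 0 = 0.
Proof. by rewrite dotC dot0l. Qed.

Lemma dotNl u v : dot (- u) v = - dot u v.
Proof. by rewrite -scaleN1r dotZl mulN1r. Qed.

Lemma dotNr u v : dot u (- v) = - dot u v.
Proof. by rewrite dotC dotNl dotC. Qed.

Lemma dotBl u v w : dot (u - v) w = dot u w - dot v w.
Proof. by rewrite dotDl dotNl. Qed.

Lemma dotBr u v w : dot u (v - w) = dot u v - dot u w.
Proof. by rewrite dotDr dotNr. Qed.

Lemma dot_subsqr u v : dot (u - v) (u - v) = dot u u - 2 * dot u v + dot v v.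
Proof. rewrite dotBl !dotBr (dotC v u); ring. Qed.

Lemma dot_suml (I : finType) (F : I -> 'cV[R]_n) v :
  dot (\sum_i F i) v = \sum_i dot (F i) v.
Proof.
apply: (big_morph (fun u => dot u v)) => [u w|]; first exact: dotDl.
exact: dot0l.
Qed.

Lemma dot_mulmx A u v : A^T = A -> dot u (A *m v) = dot (A *m u) v.
Proof. by move=> symA; rewrite /dot trmx_mul symA mulmxA. Qed.

Lemma dot_ge0 u : 0 <= dot u u.
Proof. by rewrite dotE sumr_ge0// => i _; rewrite -expr2 sqr_ge0. Qed.

Lemma enorm_ge0 u : 0 <= enorm u.
Proof. exact: sqrtr_ge0. Qed.

Lemma enorm_sqr u : enorm u ^+ 2 = dot u u.
Proof. by rewrite sqr_sqrtr ?dot_ge0. Qed.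

Lemma dot_eq0 u : dot u u = 0 -> u = 0.
Proof.
rewrite dotE => /eqP; rewrite psumr_eq0 => [/allP u0|i _]; last first.
  by rewrite -expr2 sqr_ge0.
apply/matrixP => i j; rewrite ord1 mxE.
by have := u0 i (mem_index_enum _); rewrite mulf_eq0 orbb => /eqP.
Qed.

Lemma enorm_gt0 u : u <> 0 -> 0 < enorm u.
Proof.
move=> u0; rewrite sqrtr_gt0 lt_def dot_ge0 andbT.
by apply/eqP => /dot_eq0.
Qed.

Lemma enormZ c u : enorm (c *: u) = `|c| * enorm u.
Proof.
by rewrite /enorm dotZl dotZr mulrA -expr2 sqrtrM ?sqr_ge0// sqrtr_sqr.
Qed.

Lemma enormN u : enorm (- u) = enorm u.
Proof. by rewrite -scaleN1r enormZ normrN1 mul1r. Qed.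

Lemma dot_le u v : dot u v <= enorm u * enorm v.
Proof.
have [->|/eqP/enorm_gt0 u0] := eqVneq u 0.
  by rewrite dot0l mulr_ge0 ?enorm_ge0.
have [->|/eqP/enorm_gt0 v0] := eqVneq v 0.
  by rewrite dot0r mulr_ge0 ?enorm_ge0.
(* this vector vanishes exactly in the equality case *)
have := dot_ge0 (enorm v *: u - enorm u *: v).
rewrite dotBl !dotBr !dotZl !dotZr (dotC v u) -!enorm_sqr => h.
have uv0 : 0 < enorm u * enorm v by rewrite mulr_gt0.
rewrite -(ler_pM2l uv0); nra.
Qed.

Lemma enormD u v : enorm (u + v) <= enorm u + enorm v.
Proof.
rewrite -(ler_pXn2r (n := 2)) ?nnegrE ?addr_ge0 ?enorm_ge0//.
rewrite enorm_sqr dotDl !dotDr (dotC v u) sqrrD !enorm_sqr.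
by have := dot_le u v; lra.
Qed.

Lemma norm_coord_le u i : `|u i 0| <= enorm u.
Proof.
rewrite -sqrtr_sqr ler_wsqrtr// dotE (bigD1 i)//= -expr2 lerDl.
by rewrite sumr_ge0// => j _; rewrite -expr2 sqr_ge0.
Qed.

Lemma enorm_le_sum u : enorm u <= \sum_i `|u i 0|.
Proof.
have s0 : 0 <= \sum_i `|u i 0| by rewrite sumr_ge0.
rewrite -(ler_pXn2r (n := 2)) ?nnegrE ?enorm_ge0//.
rewrite enorm_sqr dotE expr2 mulr_suml.
apply: ler_sum => i _; apply: le_trans (ler_norm _) _.
rewrite normrM ler_wpM2l// (bigD1 i)//= lerDl.
by rewrite sumr_ge0.
Qed.

Lemma enorm_mulmx_le A u c : (forall i j, `|A i j| <= c) ->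
  enorm (A *m u) <= n%:R ^+ 2 * c * enorm u.
Proof.
move=> Ac; apply: le_trans (enorm_le_sum _) _.
have -> : n%:R ^+ 2 * c * enorm u = \sum_(i < n) \sum_(j < n) c * enorm u.
  by rewrite !sumr_const card_ord -mulrnA -[RHS]mulr_natr natrM; ring.
apply: ler_sum => i _; rewrite mxE; apply: le_trans (ler_norm_sum _ _ _) _.
apply: ler_sum => j _; rewrite normrM ler_pM ?normr_ge0//.
exact: norm_coord_le.
Qed.

Lemma dot_mulmx_le A u c : (forall i j, `|A i j| <= c) ->
  dot u (A *m u) <= n%:R ^+ 2 * c * enorm u ^+ 2.
Proof.
move=> Ac; apply: le_trans (dot_le _ _) _.
rewrite [leRHS](_ : _ = enorm u * (n%:R ^+ 2 * c * enorm u)); last by ring.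
by rewrite ler_wpM2l ?enorm_ge0 ?enorm_mulmx_le.
Qed.

(** The entries of A bound the supremum in the definition, so the supremum is
    a genuine upper bound; the inequality then follows by scaling. *)
Lemma spectral_norm_le A u M : spectral_norm A <= M ->
  enorm (A *m u) <= M * enorm u.
Proof.
move=> AM.
have [->|/eqP/enorm_gt0 u0] := eqVneq u 0.
  by rewrite mulmx0 (_ : enorm 0 = 0) ?mulr0// /enorm dot0l sqrtr0.
have entry_le i j : `|A i j| <= \sum_k \sum_l `|A k l|.
  rewrite (bigD1 i)//= (bigD1 j)//= -addrA lerDl addr_ge0 ?sumr_ge0// => k _.
  by rewrite sumr_ge0.
have [v v1 uE] : exists2 v, enorm v = 1 & u = enorm u *: v.
  exists ((enorm u)^-1 *: u).
    by rewrite enormZ ger0_norm ?invr_ge0 ?enorm_ge0// mulVf ?gt_eqF.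
  by rewrite scalerA divff ?gt_eqF// scale1r.
rewrite {1}uE -scalemxAr enormZ ger0_norm ?enorm_ge0// mulrC.
rewrite ler_wpM2r ?enorm_ge0//; apply: le_trans AM.
apply: ub_le_sup; last by exists v => //=; rewrite v1.
exists (n%:R ^+ 2 * \sum_k \sum_l `|A k l|) => _ [w /= w1 <-].
apply: le_trans (enorm_mulmx_le w entry_le) _.
by rewrite ler_piMr// mulr_ge0 ?exprn_ge0// sumr_ge0// => k _; rewrite sumr_ge0.
Qed.

End EuclideanNorm.

(** * MINRES before negative curvature is detected *)

Section MinresResiduals.
Context {R : realType} {n : nat}.
Variables (A : 'M[R]_n) (b : 'cV[R]_n) (p : nat -> 'cV[R]_n).
Hypothesis symA : A^T = A.
Hypothesis pP : forall t, is_minres_iterate A b t (p t).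
Implicit Types t : nat.

Local Notation K := (krylov A b).
Local Notation r t := (b - A *m p t).

Lemma krylov_mono t t' v : (t <= t')%N -> v \in K t -> v \in K t'.
Proof.
move=> tt'; apply: subvP; apply: sub_span => _ /mapP [i it ->].
apply/mapP; exists i => //; move: it.
by rewrite !mem_iota !add0n => /leq_trans ->.
Qed.

Lemma mem_krylov0 t : b \in K t.+1.
Proof.
apply: memv_span; apply/mapP; exists 0%N; first by rewrite mem_iota.
by rewrite expr0 mul1mx.
Qed.

Lemma mulmx_krylov t v : v \in K t -> A *m v \in K t.+1.
Proof.
move=> /coord_span ->; rewrite mulmx_sumr rpred_sum// => i _.
rewrite -scalemxAr rpredZ// memv_span//.
have it := ltn_ord i.
rewrite (nth_map 0%N) ?size_iota// nth_iota// add0n.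
apply/mapP; exists i.+1; first by rewrite mem_iota.
by rewrite mulmxA exprS.
Qed.

Lemma residual_krylov t : r t \in K t.+1.
Proof. by rewrite rpredB ?mem_krylov0 ?mulmx_krylov//; case: (pP t). Qed.

(** First-order optimality of p_t: moving from p_t along q by the step that
    minimizes the residual must gain nothing. *)
Lemma residual_orthogonal t q : q \in K t -> dot (r t) (A *m q) = 0.
Proof.
move=> qK; have [pK pmin] := pP t.
have [/dot_eq0->|/eqP w0] := eqVneq (dot (A *m q) (A *m q)) 0.
  by rewrite dot0r.
(* e is the step that minimizes the residual along q *)
set w := A *m q in w0 *; set e := dot (r t) w / dot w w.
have w_gt0 : 0 < dot w w by rewrite lt_def dot_ge0 andbT; apply/eqP.
have := pmin (p t + e *: q); rewrite rpredD ?rpredZ// => /(_ isT).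
rewrite -(ler_pXn2r (n := 2)) ?nnegrE ?enorm_ge0// !enorm_sqr.
rewrite mulmxDr -scalemxAr opprD addrA -/w -/(r t).
rewrite [leRHS]dot_subsqr !dotZl !dotZr => min_e.
have ew : e * dot w w = dot (r t) w by rewrite /e divfK ?gt_eqF.
have /eqP : dot (r t) w * e = 0.
  apply/eqP; rewrite eq_le; apply/andP; split; last first.
    by rewrite -ew mulrAC -expr2 mulr_ge0 ?sqr_ge0// ltW.
  by move: min_e; rewrite -!ew; lra.
rewrite mulf_eq0 => /orP[/eqP//|/eqP e0].
by rewrite -ew e0 mul0r.
Qed.

(** r_i - r_t = A (p_t - p_i) with p_t - p_i in K_t, and r_t is orthogonal to
    A K_t. *)
Lemma dot_residual i t : (i <= t)%N -> dot (r i) (r t) = dot (r t) (r t).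
Proof.
move=> it; have -> : r i = r t + A *m (p t - p i).
  by rewrite mulmxBr addrA subrK.
rewrite dotDl (dotC (A *m _)) residual_orthogonal ?addr0//.
rewrite rpredB//; first by case: (pP t).
by apply: krylov_mono it _; case: (pP i).
Qed.

(** r_i lies in K_(i+1), which K_j contains, and r_j is orthogonal to A K_j. *)
Lemma residual_conjugate i j : (i < j)%N -> dot (r i) (A *m r j) = 0.
Proof.
move=> ij; rewrite dot_mulmx// dotC residual_orthogonal//.
exact: krylov_mono ij (residual_krylov i).
Qed.

Lemma dot_residual_le i t : (i <= t)%N ->
  dot (r t) (r t) <= dot (r i) (r i).
Proof.
move=> it; have := dot_ge0 (r i - r t).
rewrite dot_subsqr (dot_residual it); lra.
Qed.

Hypothesis p0 : p 0 = 0.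

Lemma dot_residual_rhs t : dot (r t) b = dot (r t) (r t).
Proof.
by rewrite dotC -(dot_residual (leq0n t)) p0 mulmx0 subr0.
Qed.

(** Conjugacy and positive curvature make r_0, ..., r_(t-1) linearly
    independent, hence a basis of K_t by a dimension count.  Pairing p_t with
    A r_i isolates the i-th coordinate: c_i (r_i . A r_i) = r_i . (b - r_t) =
    |r_i|^2 - |r_t|^2, which is nonnegative because residuals shrink. *)
Lemma iterate_conic t : (forall i, (i < t)%N -> 0 < dot (r i) (A *m r i)) ->
  exists2 c : 'I_t -> R, forall i : 'I_t, 0 <= c i
    & p t = \sum_(i < t) c i *: r i.
Proof.
move=> pos; pose X := mktuple (fun i : 'I_t => r i).
have XE (i : 'I_t) : (nth 0 X i) = r i by rewrite -tnth_nth tnth_mktuple.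
have curvature (c : 'I_t -> R) (i : 'I_t) :
    dot (\sum_j c j *: r j) (A *m r i) = c i * dot (r i) (A *m r i).
  rewrite dot_suml (bigD1 i)//= dotZl big1 ?addr0// => j ji; rewrite dotZl.
  have /orP[lt|lt] : (j < i)%N || (i < j)%N by rewrite -neq_ltn.
    by rewrite residual_conjugate ?mulr0.
  by rewrite dot_mulmx// dotC residual_conjugate ?mulr0.
have freeX : free X.
  apply/freeP => c c0 i; have := curvature c i.
  under eq_bigr do rewrite -XE.
  rewrite c0 dot0l => /esym/eqP; rewrite mulf_eq0 => /orP[/eqP//|].
  by rewrite gt_eqF ?pos.
have XK : K t = <<X>>%VS.
  apply/esym/eqP; rewrite eqEdim; apply/andP; split.
    apply/span_subvP => _ /mapP [i _ ->].
    exact: krylov_mono (ltn_ord i) (residual_krylov i).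
  move: freeX; rewrite /free size_tuple => /eqP ->.
  by apply: leq_trans (dim_span _) _; rewrite size_map size_iota.
have pX : p t = \sum_(i < t) coord X i (p t) *: r i.
  rewrite [LHS](@coord_span _ _ _ X); first by under eq_bigr do rewrite XE.
  by rewrite -XK; case: (pP t).
exists (fun i => coord X i (p t)) => // i.
have := curvature (fun j => coord X j (p t)) i; rewrite -pX.
have -> : dot (p t) (A *m r i) = dot (r i) (r i) - dot (r t) (r t).
  rewrite dot_mulmx// dotC -(dot_residual (ltnW (ltn_ord i))).
  rewrite -(dot_residual_rhs i) -dotBr; congr dot.
  by rewrite opprB addrC subrK.
move=> /esym cE; rewrite -(pmulr_lge0 _ (pos i (ltn_ord i))) cE subr_ge0.
exact/dot_residual_le/ltnW.
Qed.

(** p_t is a nonnegative combination of the r_i, and each r_i . r_t equals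
    |r_t|^2. *)
Lemma dot_iterate_residual_ge0 t :
  (forall i, (i < t)%N -> 0 < dot (r i) (A *m r i)) ->
  0 <= dot (p t) (r t).
Proof.
move=> /iterate_conic [c c0 pc]; rewrite {1}pc dot_suml sumr_ge0// => i _.
by rewrite dotZl (dot_residual (ltnW (ltn_ord i))) mulr_ge0 ?dot_ge0.
Qed.

Lemma curvature_le_dot_rhs t :
  (forall i, (i < t)%N -> 0 < dot (r i) (A *m r i)) ->
  dot (p t) (A *m p t) <= dot (p t) b.
Proof. by move=> /dot_iterate_residual_ge0; rewrite dotBr subr_ge0. Qed.

Lemma residual_pythagoras t :
  dot b b = dot (r t) (r t) + dot (A *m p t) (A *m p t).
Proof.
have -> : dot (A *m p t) (A *m p t) = dot (b - r t) (b - r t).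
  by rewrite opprB addrC subrK.
rewrite dot_subsqr (dotC b) dot_residual_rhs; ring.
Qed.

(** With p_t = sum of c_i r_i one has p_t . r_t = (sum of c_i) |r_t|^2 and
    p_t . A p_t = sum of c_i (|r_i|^2 - |r_t|^2), where each difference is at
    most |b|^2 - |r_t|^2 = |A p_t|^2.  This forbids a residual that is still
    close to b while A is well conditioned along p_t. *)
Lemma curvature_le_progress t :
  (forall i, (i < t)%N -> 0 < dot (r i) (A *m r i)) ->
  dot (p t) (A *m p t) * dot (r t) (r t) <=
  dot (A *m p t) (A *m p t) * dot (p t) (r t).
Proof.
move=> /iterate_conic [c c0 pc].
have pr v : dot (p t) v = \sum_(i < t) c i * dot (r i) v.
  by rewrite {1}pc dot_suml; under eq_bigr do rewrite dotZl.
have -> : dot (p t) (r t) = (\sum_i c i) * dot (r t) (r t).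
  rewrite pr mulr_suml; apply: eq_bigr => i _.
  by rewrite (dot_residual (ltnW (ltn_ord i))).
rewrite mulrA ler_wpM2r ?dot_ge0// pr mulr_sumr; apply: ler_sum => i _.
rewrite mulrC ler_wpM2r//.
rewrite {1}(_ : A *m p t = b - r t); last by rewrite opprB addrC subrK.
rewrite [leLHS]dotBr dot_residual_rhs (dot_residual (ltnW (ltn_ord i))).
have := dot_residual_le (leq0n i); rewrite p0 mulmx0 subr0.
rewrite (residual_pythagoras t); lra.
Qed.

Lemma iterate_neq0 t :
  (forall i, (i < t.+1)%N -> 0 < dot (r i) (A *m r i)) -> p t.+1 <> 0.
Proof.
move=> /(_ 0%N isT); rewrite p0 mulmx0 subr0 => bAb pt0.
have := residual_orthogonal (krylov_mono (ltn0Sn t) (mem_krylov0 0)).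
by rewrite pt0 mulmx0 subr0 => bAb0; rewrite bAb0 ltxx in bAb.
Qed.

(** Write P, Q, S for |p|, |A p|, |r| at iteration t + 1.
    [curvature_le_progress] and the Cauchy-Schwarz inequality give
    c P^2 S^2 <= Q^2 P S; as P > 0 and Q <= M P, this yields c S <= M Q, that
    is, a residual of the size of b forces A p to be of that size too.  As
    |b|^2 = S^2 + Q^2, Q and hence P are at least a multiple of |b|, and
    p . b >= p . A p >= c P^2. *)
Lemma dot_rhs_ge t c M :
  (forall i, (i < t.+1)%N -> 0 < dot (r i) (A *m r i)) -> 0 < c -> 0 < M ->
  enorm (A *m p t.+1) <= M * enorm (p t.+1) ->
  c * dot (p t.+1) (p t.+1) <= dot (p t.+1) (A *m p t.+1) ->
  c ^+ 3 / (M ^+ 2 * (M ^+ 2 + c ^+ 2)) * enorm b ^+ 2 <= dot (p t.+1) b.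
Proof.
move=> pos c0 M0 ApM cp.
set P := enorm (p t.+1); set Q := enorm (A *m p t.+1); set S := enorm (r t.+1).
have [P0 Q0 S0] : [/\ 0 <= P, 0 <= Q & 0 <= S] by rewrite !enorm_ge0.
have {}P0 : 0 < P by rewrite enorm_gt0//; exact: iterate_neq0 pos.
have bE : enorm b ^+ 2 = S ^+ 2 + Q ^+ 2.
  by rewrite !enorm_sqr (residual_pythagoras t.+1).
have cpb : c * P ^+ 2 <= dot (p t.+1) b.
  by rewrite enorm_sqr; apply: le_trans cp (curvature_le_dot_rhs pos).
have cPS : c * P ^+ 2 * S ^+ 2 <= Q ^+ 2 * (P * S).
  rewrite !enorm_sqr; apply: le_trans (ler_wpM2r (dot_ge0 _) cp) _.
  apply: le_trans (curvature_le_progress pos) _.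
  by rewrite ler_wpM2l ?dot_ge0 ?dot_le.
have QS : c * S <= M * Q.
  have [->|/eqP S1] := eqVneq S 0; first by rewrite mulr0 mulr_ge0// ltW.
  have {}S0 : 0 < S by rewrite lt_def S0 andbT; apply/eqP.
  rewrite -(ler_pM2r (mulr_gt0 (exprn_gt0 2 P0) S0)).
  rewrite (_ : c * S * _ = c * P ^+ 2 * S ^+ 2); last by ring.
  apply: le_trans cPS _.
  rewrite (_ : Q ^+ 2 * _ = Q * (Q * P * S)); last by ring.
  rewrite (_ : M * Q * _ = Q * (M * P * P * S)); last by ring.
  by rewrite ler_wpM2l// ler_wpM2r ?(ltW S0)// ler_wpM2r// ltW.
have bQ : c ^+ 2 * enorm b ^+ 2 <= (M ^+ 2 + c ^+ 2) * Q ^+ 2.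
  have : (c * S) ^+ 2 <= (M * Q) ^+ 2.
    by rewrite ler_pXn2r// nnegrE mulr_ge0// ltW.
  rewrite bE !exprMn; lra.
have bP : c ^+ 2 * enorm b ^+ 2 <= (M ^+ 2 + c ^+ 2) * (M ^+ 2 * P ^+ 2).
  apply: le_trans bQ _; rewrite ler_wpM2l ?addr_ge0 ?sqr_ge0//.
  by rewrite -exprMn ler_pXn2r// nnegrE ?mulr_ge0// ltW.
have D0 : 0 < M ^+ 2 * (M ^+ 2 + c ^+ 2).
  by rewrite mulr_gt0 ?exprn_gt0// addr_gt0 ?exprn_gt0.
apply: le_trans cpb; rewrite mulrAC ler_pdivrMr//.
rewrite (_ : c ^+ 3 * _ = c * (c ^+ 2 * enorm b ^+ 2)); last by ring.
rewrite -[leRHS]mulrA ler_wpM2l ?(ltW c0)//; apply: le_trans bP _.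
by rewrite le_eqVlt; apply/orP; left; apply/eqP; ring.
Qed.

End MinresResiduals.

Section MinresOutput.
Context {R : realType} {n : nat}.
Implicit Types (A : 'M[R]_n) (b d : 'cV[R]_n) (theta c M : R).

Lemma minres_iterates A b (p : nat -> 'cV[R]_n) : p 0%N = 0 ->
  (forall t, (0 < t)%N -> is_minres_iterate A b t (p t)) ->
  forall t, is_minres_iterate A b t (p t).
Proof.
move=> p0 pP [|t]; last exact: pP.
split=> [|q]; first by rewrite p0 mem0v.
by rewrite /krylov /= span_nil memv0 => /eqP ->; rewrite p0.
Qed.

Lemma minres_flag A b theta d fl : minres A b theta d fl -> fl <> GD.
Proof. by case=> p [_ _ [t _ [[_ _ ->]|[_ _ _ ->]]]]. Qed.

(** The first bound makes the direction a descent direction in all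
    circumstances; the second makes it uniformly so when c and M are fixed. *)
Lemma minres_SOL A b theta d : A^T = A -> minres A b theta d SOL ->
  dot d (A *m d) <= dot d b /\
  forall c M, 0 < c -> 0 < M -> enorm (A *m d) <= M * enorm d ->
    c * enorm d ^+ 2 <= dot d (A *m d) ->
    c ^+ 3 / (M ^+ 2 * (M ^+ 2 + c ^+ 2)) * enorm b ^+ 2 <= dot d b.
Proof.
move=> symA [p [p0 /(minres_iterates p0) pP [t early [[]//|[npc _ -> _]]]]].
have pos i : (i < t.+1)%N -> 0 < dot (b - A *m p i) (A *m (b - A *m p i)).
  rewrite ltnS leq_eqVlt => /orP[/eqP ->|/early [npc_i _]].
    by rewrite ltNge; apply/negP.
  by rewrite ltNge; apply/negP.
split; first exact: curvature_le_dot_rhs pos.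
move=> c M c0 M0 AM; rewrite enorm_sqr; exact: dot_rhs_ge pos c0 M0 AM.
Qed.

(** The stopping test failed before iteration t, so |r_t| > theta |b| unless
    t = 0, where r_0 = b; this explains the minimum with 1. *)
Lemma minres_NPC A b theta d : A^T = A -> b <> 0 -> 0 <= theta ->
  minres A b theta d NPC ->
  [/\ enorm d = enorm b, dot d (A *m d) <= 0
    & Num.min 1 theta * enorm b ^+ 2 <= dot d b].
Proof.
move=> symA b0 theta0.
move=> [p [p0 /(minres_iterates p0) pP [t early [[npc -> _]|[]//]]]].
set r := b - A *m p t.
have rge : Num.min 1 theta * enorm b <= enorm r.
  case: t early @r {npc} => [_ r|t /(_ t (ltnSn t))[_ /negP + r]].
    by rewrite /r p0 mulmx0 subr0 ler_piMl ?enorm_ge0// ge_min lexx.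
  rewrite -ltNge => /ltW; apply: le_trans.
  by rewrite ler_wpM2r ?enorm_ge0// ge_min lexx orbT.
have r_gt0 : 0 < enorm r.
  rewrite lt_def enorm_ge0 andbT; apply/eqP => r0.
  case: t early @r r0 {npc rge} => [_ r r0|t /(_ t (ltnSn t))[_ /negP + r r0]].
    move: r0; rewrite /r p0 mulmx0 subr0; apply/eqP.
    by rewrite gt_eqF ?enorm_gt0.
  by rewrite -/r r0 => /negP; apply; rewrite mulr_ge0 ?enorm_ge0.
have q0 : 0 <= enorm b / enorm r by rewrite divr_ge0 ?enorm_ge0.
split.
- by rewrite enormZ ger0_norm// divfK ?gt_eqF.
- by rewrite -scalemxAr dotZl dotZr !mulr_ge0_le0.
rewrite dotZl (dot_residual_rhs pP p0) -/r -enorm_sqr.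
rewrite [leRHS](_ : _ = enorm b * enorm r).
  by rewrite expr2 mulrCA ler_wpM2l ?enorm_ge0.
by rewrite [enorm r ^+ 2]expr2 mulrA divfK ?gt_eqF.
Qed.

End MinresOutput.

(** * Second-order upper bounds *)

Section Taylor.
Context {R : realType} {n : nat}.
Implicit Types (f F : 'cV[R]_n -> R) (x y h : 'cV[R]_n) (t : R).

(** Expand h in the canonical basis. *)
Lemma diff_gradient F y h : differentiable F y ->
  'd F y h = dot (gradient F y) h.
Proof.
move=> dF.
have {1}-> : h = \sum_i h i 0 *: basis_vec i.
  apply/matrixP => i j; rewrite ord1 summxE (bigD1 i)//= big1 => [|k ki].
    by rewrite !mxE !eqxx mulr1 addr0.
  by rewrite !mxE eq_sym (negbTE ki) mulr0.
rewrite linear_sum dotE; apply: eq_bigr => i _.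
by rewrite linearZ mxE deriveE// mulrC.
Qed.

Lemma is_derive_line F x h t : differentiable F (x + t *: h) ->
  is_derive t 1 (fun s : R => F (x + s *: h)) (dot (gradient F (x + t *: h)) h).
Proof.
move=> dF; pose g (s : R) := x + s *: h.
have dlin : is_diff t ( *:%R^~ h : R -> 'cV[R]_n) ( *:%R^~ h).
  exact: is_diff_scalel.
have dcst : is_diff t (cst x : R -> 'cV[R]_n) (0 : R -> 'cV[R]_n).
  exact: is_diff_cst.
have dg : is_diff t g (fun s => s *: h).
  by have := is_diffD dcst dlin; rewrite add0r.
have dFg : differentiable (F \o g) t by apply: differentiable_comp.
apply: DeriveDef; first exact/diff_derivable.
by rewrite deriveE// diff_comp//= diff_val scale1r diff_gradient.
Qed.

(** Apply the mean value theorem to phi(t) - t phi'(0) - c t^2 / 2, where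
    phi(t) = f (x + t h), and once more to phi': the second derivative of phi
    is h . H(x + t h) h, which is at most c. *)
Lemma second_order_bound f x h c : twice_continuously_differentiable f ->
  (forall t, 0 <= t <= 1 -> dot h (hessian f (x + t *: h) *m h) <= c) ->
  f (x + h) <= f x + dot (gradient f x) h + c / 2.
Proof.
move=> [df dg _] Hc.
pose phi (t : R) := f (x + t *: h).
pose dphi (t : R) := dot (gradient f (x + t *: h)) h.
pose ddphi (t : R) := dot h (hessian f (x + t *: h) *m h).
have phiP t : is_derive t 1 phi (dphi t) by apply: is_derive_line.
have dphiP t : is_derive t 1 dphi (ddphi t).
  have dfi i : differentiable (fun y => 'D_(basis_vec i) f y) (x + t *: h).
    have -> : (fun y => 'D_(basis_vec i) f y) =
        (fun v : 'cV[R]_n => v i 0) \o gradient f.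
      by apply/funext => y /=; rewrite mxE.
    by apply: differentiable_comp; [exact: dg|exact: differentiable_coord].
  have -> : dphi = \sum_i (fun t => h i 0 *: 'D_(basis_vec i) f (x + t *: h)).
    apply/funext => s; rewrite /dphi dotE fct_sumE; apply: eq_bigr => i _.
    by rewrite mxE mulrC.
  have -> : ddphi t = \sum_i
      h i 0 *: dot (gradient (fun y => 'D_(basis_vec i) f y) (x + t *: h)) h.
    rewrite /ddphi dotE; apply: eq_bigr => i _; congr (_ * _).
    by rewrite mxE dotE; apply: eq_bigr => j _; rewrite !mxE.
  apply: is_derive_sum => i; apply: is_deriveZ.
  exact: is_derive_line.
have cont (u : R -> R) du : (forall t, is_derive t 1 u (du t)) ->
    forall a b, {within `[a, b], continuous u}.
  move=> uP a b; apply: derivable_within_continuous => t _.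
  by have [] := uP t.
pose psi (t : R) := phi t - t * dphi 0 - c / 2 * t ^+ 2.
have psiP t : is_derive t 1 psi (dphi t - dphi 0 - c * t).
  have -> : psi = phi - dphi 0 *: id - (c / 2) *: (id ^+ 2 : R -> R).
    by apply/funext => s /=; rewrite /psi (mulrC s).
  apply: is_derive_eq; rewrite /= expr1 /GRing.scale /=; lra.
have [t /andP[/= t0 t1]] := MVT ltr01 (fun t _ => psiP t) (cont _ _ psiP _ _).
have : dphi t - dphi 0 - c * t <= 0.
  have [s /andP[/= s0 st] sE] :=
    MVT t0 (fun t _ => dphiP t) (cont _ _ dphiP _ _).
  rewrite sE subr0 -mulrBl pmulr_lle0// subr_le0; apply: Hc.
  by move: s0 st t1; rewrite !bnd_simp; lra.
rewrite /psi /phi /dphi scale0r addr0 scale1r; lra.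
Qed.

(** Continuity of the Hessian at [xstar] keeps its entries within e of
    those at [xstar], hence within 2 e of those at x; an entrywise bound 2 e
    changes the quadratic form by at most 2 e n^2 |h|^2. *)
Lemma local_second_order_bound f (xstar : 'cV[R]_n) kappa :
  twice_continuously_differentiable f -> 0 < kappa ->
  exists2 delta, 0 < delta &
    \forall x \near xstar, forall h, enorm h < delta ->
      f (x + h) <= f x + dot (gradient f x) h
        + (dot h (hessian f x *m h) + kappa * enorm h ^+ 2) / 2.
Proof.
move=> fC2 kappa0; have [_ _ /(_ xstar) cH] := fC2.
pose N : R := n%:R ^+ 2; pose e := kappa / (2 * (N + 1)).
have N0 : 0 <= N by rewrite exprn_ge0.
have e0 : 0 < e by rewrite divr_gt0// mulr_gt0// ltr_pwDr.
have Ne : N * (2 * e) <= kappa.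
  have <- : e * (2 * (N + 1)) = kappa.
    by rewrite divfK// gt_eqF// mulr_gt0// ltr_pwDr.
  by lra.
have /nbhs_ballP [d /= d0 dH] := cH _ (nbhsx_ballx (hessian f xstar) e e0).
exists (d / 2); first by rewrite divr_gt0.
have d20 : 0 < d / 2 by rewrite divr_gt0.
apply: filterS (nbhsx_ballx xstar (d / 2) d20) => x [_ xd] h hd.
have close t : 0 <= t <= 1 ->
    ball (hessian f xstar) e (hessian f (x + t *: h)).
  move=> /andP[t0 t1]; apply: dH; split=> // i j.
  rewrite /ball/= !mxE opprD addrA; have := xd i j; rewrite /ball/= => xdij.
  have : `|t * h i j| < d / 2.
    rewrite normrM ger0_norm//; apply: le_lt_trans hd.
    rewrite ord1; apply: le_trans (norm_coord_le _ i).
    by rewrite ler_piMl.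
  have := ler_normB (xstar i j - x i j) (t * h i j); lra.
rewrite -addrA addrA; apply: second_order_bound => // t t01.
have -> : hessian f (x + t *: h) =
    hessian f x + (hessian f (x + t *: h) - hessian f x).
  by rewrite [RHS]addrC subrK.
rewrite mulmxDl dotDr lerD2l.
suff He i j : `|(hessian f (x + t *: h) - hessian f x) i j| <= 2 * e.
  by apply: le_trans (dot_mulmx_le h He) _; rewrite ler_wpM2r ?sqr_ge0.
have zero01 : 0 <= (0 : R) <= 1 by apply/andP; split.
have [[_ /(_ i j)] + [_ /(_ i j)]] := (close t t01, close 0 zero01).
rewrite scale0r addr0 /ball/=.
have -> : forall X Y : 'M[R]_n, (X - Y) i j = X i j - Y i j.
  by move=> X Y; rewrite !mxE.
move=> h1 h2; apply: le_trans (ler_distD (hessian f xstar i j) _ _) _.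
rewrite mulr_natl mulr2n; apply: lerD; last exact: ltW h2.
rewrite distrC; exact: ltW h1.
Qed.

Lemma hessian_locally_bounded f (xstar : 'cV[R]_n) :
  twice_continuously_differentiable f ->
  exists2 M, 0 < M &
    \forall x \near xstar, forall h, enorm (hessian f x *m h) <= M * enorm h.
Proof.
move=> [_ _ /(_ xstar) cH].
pose C := \sum_i \sum_j `|hessian f xstar i j| + 1.
have C0 : 0 <= C.
  by rewrite addr_ge0// sumr_ge0// => i _; rewrite sumr_ge0.
exists (n%:R ^+ 2 * C + 1); first by rewrite ltr_pwDr// mulr_ge0// exprn_ge0.
have near_xstar : \forall x \near xstar, ball (hessian f xstar) 1 (hessian f x).
  exact: cH _ (nbhsx_ballx (hessian f xstar) 1 ltr01).
apply: filterS near_xstar => x [_ xH] h.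
suff HC i j : `|hessian f x i j| <= C.
  apply: le_trans (enorm_mulmx_le h HC) _.
  by rewrite ler_wpM2r ?enorm_ge0// lerDl.
rewrite -[hessian f x i j](subrKC (hessian f xstar i j)).
apply: le_trans (ler_normD _ _) _; apply: lerD.
  rewrite (bigD1 i)//= (bigD1 j)//= -addrA lerDl addr_ge0 ?sumr_ge0// => k _.
  by rewrite sumr_ge0.
rewrite distrC; exact/ltW/(xH i j).
Qed.

Lemma gradient_continuous f : twice_continuously_differentiable f ->
  continuous (fun x => enorm (gradient f x)).
Proof.
move=> [_ dg _] x.
have -> : (fun x => enorm (gradient f x)) =
    Num.sqrt \o (fun x => \sum_i gradient f x i 0 * gradient f x i 0).
  by apply/funext => y /=; rewrite /enorm dotE.
apply: continuous_comp; last exact: sqrt_continuous.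
apply: (@cvg_big _ _ _ _ _ add_continuous _ (nbhs x)) => i _.
have gi : {for x, continuous (fun y => gradient f y i 0)}.
  apply: (@continuous_comp _ _ _ (gradient f) (fun v : 'cV[R]_n => v i 0)).
    exact: differentiable_continuous.
  exact: coord_continuous.
exact: cvgM.
Qed.

End Taylor.

(** * Linesearches and search directions *)

Section StepSizes.
Context {R : realType}.
Variables s rho : R.
Hypotheses (s_gt0 : 0 < s) (rho_gt0 : 0 < rho) (rho_lt1 : rho < 1).
Implicit Types (P : R -> Prop) (lam : R).

(** Unless the initial step is accepted, the trial step before the accepted
    one was rejected, so it exceeds every t0 such that P holds on (0, t0]. *)
Lemma backtrackingP P lam : backtracking s rho P lam ->
  [/\ 0 < lam, P lam & forall t0, (forall t, 0 < t <= t0 -> P t) ->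
      Num.min s (rho * t0) <= lam].
Proof.
move=> [j [-> Pj minj]]; split=> // [|t0 Pt0].
  by rewrite mulr_gt0 ?exprn_gt0.
case: j Pj minj => [|j] _ minj; first by rewrite expr0 mulr1 ge_min lexx.
rewrite exprS mulrCA ge_min ler_pM2l//; apply/orP; right.
apply/ltW; rewrite ltNge; apply/negP => le_t0.
have /minj : P (s * rho ^+ j) by apply: Pt0; rewrite le_t0 mulr_gt0 ?exprn_gt0.
by rewrite ltnn.
Qed.

(** The forward branch returns at least s, and the backward one is bounded
    below as in [backtrackingP]; there the trial step before the first one is
    s itself, which has been rejected. *)
Lemma npc_linesearchP P lam : npc_linesearch s rho P lam ->
  [/\ 0 < lam, P lam & forall t0, (forall t, 0 < t <= t0 -> P t) ->
      Num.min s (rho * t0) <= lam].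
Proof.
move=> [backward forward]; have [Ps|nPs] := pselect (P s).
  have [j [-> Pj _]] := forward Ps.
  have s_le : s <= s * rho ^- j.
    by rewrite ler_pdivlMr ?exprn_gt0// ler_piMr ?exprn_ile1// ltW.
  split; [exact: lt_le_trans s_le|exact: Pj|move=> t0 _].
  by rewrite ge_min s_le.
have [j [j0 -> Pj minj]] := backward nPs.
split=> // [|t0 Pt0]; first by rewrite mulr_gt0 ?exprn_gt0.
case: j j0 Pj minj => // j _ _ minj.
rewrite exprS mulrCA ge_min ler_pM2l//; apply/orP; right.
apply/ltW; rewrite ltNge; apply/negP => le_t0.
have Pj : P (s * rho ^+ j) by apply: Pt0; rewrite le_t0 mulr_gt0 ?exprn_gt0.
case: j minj Pj {le_t0} => [|j] minj; first by rewrite expr0 mulr1.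
by move=> /minj => /(_ isT); rewrite ltnn.
Qed.

End StepSizes.

Section Steps.
Context {R : realType} {n : nat}.
Implicit Types (f : 'cV[R]_n -> R) (x d g : 'cV[R]_n) (B : 'M[R]_n) (t q : R).

(** Common form of both linesearch conditions: q is 0 in the Armijo condition
    and d . B d in the condition used with flag NPC. *)
Definition sufficient_decrease f sigma x d q t : Prop :=
  f (x + t *: d) - f x <= sigma * (t * dot (gradient f x) d + t ^+ 2 / 2 * q).

Definition linesearch_curvature B d fl : R :=
  if fl is NPC then dot d (B *m d) else 0.

Lemma step_sizeP f s rho sigma B x d fl lam :
  0 < s -> 0 < rho -> rho < 1 -> step_size f s rho sigma B x d fl lam ->
  let q := linesearch_curvature B d fl in
  [/\ 0 < lam, sufficient_decrease f sigma x d q lam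
    & forall t0,
      (forall t, 0 < t <= t0 -> sufficient_decrease f sigma x d q t) ->
      Num.min s (rho * t0) <= lam].
Proof.
move=> s0 rho0 rho1.
have armijoE t : armijo f sigma x d t <-> sufficient_decrease f sigma x d 0 t.
  by rewrite /armijo /sufficient_decrease mulr0 addr0 mulrA (dotC d).
have npcE t : npc_decrease f sigma B x d t <->
    sufficient_decrease f sigma x d (dot d (B *m d)) t.
  rewrite /npc_decrease /sufficient_decrease [X in _ <-> _ <= X](_ : _ =
    sigma * t * dot (gradient f x) d + sigma / 2 * t ^+ 2 * dot d (B *m d)) //.
  by ring.
case: fl => /=.
- move=> /(backtrackingP s0 rho0) [lam0 /armijoE Plam low]; split=> // t0 Pt0.
  by apply: low => t /Pt0 /armijoE.
- move=> /(npc_linesearchP s0 rho0 rho1) [lam0 /npcE Plam low].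
  by split=> // t0 Pt0; apply: low => t /Pt0 /npcE.
- move=> /(backtrackingP s0 rho0) [lam0 /armijoE Plam low]; split=> // t0 Pt0.
  by apply: low => t /Pt0 /armijoE.
Qed.

(** The directions with flag SOL or GD.  For SOL the failure of the reset test
    is the curvature bound that [minres_SOL] needs; for d = - g both
    conclusions hold because c <= 1 <= M. *)
Lemma direction_descent f alpha Acap theta a zeta B x d fl c M :
  B^T = B -> Acap <= 1 -> 1 <= M -> 0 < c ->
  c <= Num.min Acap (a * enorm (gradient f x) `^ alpha) ->
  (forall u, enorm ((B + zeta%:M) *m u) <= M * enorm u) ->
  search_direction f alpha Acap theta a zeta B x d fl -> fl <> NPC ->
  c * enorm d ^+ 2 <= - dot (gradient f x) d /\
  c ^+ 3 / (M ^+ 2 * (M ^+ 2 + c ^+ 2)) * enorm (gradient f x) ^+ 2 <=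
    - dot (gradient f x) d.
Proof.
set g := gradient f x => symB A1 M1 c0 cle BM [d0 [fl0 [dmin alt]]] flN.
have symBz : (B + zeta%:M)^T = B + zeta%:M.
  by rewrite linearD/= symB tr_scalar_mx.
have M0 : 0 < M by apply: lt_le_trans M1.
have c1 : c <= 1 by apply: le_trans A1; move: cle; rewrite le_min => /andP[].
case: alt => [[_ [-> _]]|[nreset [dE flE]]].
  rewrite dotNr opprK enormN -enorm_sqr ler_piMl ?sqr_ge0//; split=> //.
  rewrite ler_piMl ?sqr_ge0// ler_pdivrMr; last first.
    by rewrite mulr_gt0 ?exprn_gt0// addr_gt0 ?exprn_gt0.
  rewrite mul1r (@le_trans _ _ 1) ?exprn_ile1 ?(ltW c0)//.
  rewrite -[leLHS]mulr1 ler_pM ?exprn_ege1//.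
  by rewrite (@le_trans _ _ (M ^+ 2)) ?exprn_ege1// lerDl sqr_ge0.
rewrite dE; rewrite flE in flN; case: fl0 dmin flN nreset {flE}
    => [dmin _ nreset|//|/minres_flag//].
have curv : c * enorm d0 ^+ 2 <= dot d0 ((B + zeta%:M) *m d0).
  rewrite leNgt; apply/negP => lt_c; apply: nreset; split=> //.
  by apply: lt_le_trans lt_c _; rewrite ler_wpM2r ?sqr_ge0.
have [le_rhs strong] := minres_SOL symBz dmin.
rewrite -dotNl -/g dotC; split; first exact: le_trans le_rhs.
by rewrite -(enormN g); apply: strong.
Qed.

(** MINRES sees the shifted matrix, along whose direction d the curvature is
    not positive; removing the shift leaves a curvature of B of at most
    - zeta |d|^2. *)
Lemma direction_npc f alpha Acap theta a zeta B x d :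
  B^T = B -> 0 <= theta -> gradient f x <> 0 ->
  search_direction f alpha Acap theta a zeta B x d NPC ->
  [/\ enorm d = enorm (gradient f x), dot d (B *m d) <= - (zeta * enorm d ^+ 2)
    & Num.min 1 theta * enorm (gradient f x) ^+ 2 <= - dot (gradient f x) d].
Proof.
move=> symB theta0 g0 [d0 [fl0 [dmin [[_ [_ //]]|[_ [dE flE]]]]]].
rewrite -dE -flE in dmin.
have symBz : (B + zeta%:M)^T = B + zeta%:M.
  by rewrite linearD/= symB tr_scalar_mx.
have g0' : - gradient f x <> 0 by move=> /eqP; rewrite oppr_eq0 => /eqP.
have [dn dc dr] := minres_NPC symBz g0' theta0 dmin.
rewrite enormN in dn dr; split=> //; last by rewrite -dotNl dotC.
move: dc; rewrite mulmxDl dotDr mul_scalar_mx dotZr -enorm_sqr; lra.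
Qed.

Lemma enorm_mulmxD_scalar B zeta M u : 0 <= zeta ->
  (forall v, enorm (B *m v) <= M * enorm v) ->
  enorm ((B + zeta%:M) *m u) <= (M + zeta) * enorm u.
Proof.
move=> zeta0 BM; rewrite mulmxDl mul_scalar_mx mulrDl.
apply: le_trans (enormD _ _) _; rewrite lerD// enormZ ger0_norm//.
Qed.

End Steps.

Section Progress.
Context {R : realType} {n : nat}.
Implicit Types (f : 'cV[R]_n -> R) (x d : 'cV[R]_n) (B : 'M[R]_n).

Lemma matrix_bounded B :
  exists2 M, 1 <= M & forall u, enorm (B *m u) <= M * enorm u.
Proof.
exists (Num.max 1 (spectral_norm B)); first by rewrite le_max lexx.
by move=> u; apply: spectral_norm_le; rewrite le_max lexx orbT.
Qed.

Lemma sufficient_decrease_le f sigma x d q lam lam0 e :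
  0 <= sigma -> 0 <= lam0 -> lam0 <= lam -> q <= 0 -> 0 <= e ->
  e <= - dot (gradient f x) d ->
  sufficient_decrease f sigma x d q lam ->
  f (x + lam *: d) <= f x - sigma * (lam0 * e).
Proof.
move=> sigma0 lam00 lamge q0 e0 ele; rewrite /sufficient_decrease lerBlDr.
move=> /le_trans; apply; rewrite [leLHS]addrC lerD2l -mulrN ler_wpM2l//.
have : lam ^+ 2 / 2 * q <= 0 by rewrite mulr_ge0_le0// divr_ge0 ?sqr_ge0.
have : lam0 * e <= lam * - dot (gradient f x) d by rewrite ler_pM.
by lra.
Qed.

(** Every direction has nonpositive slope and nonpositive curvature in its
    linesearch condition.  For fixed data any bound of the shifted matrix
    serves as M in [direction_descent]. *)
Lemma step_nonincreasing f s rho sigma alpha Acap theta a zeta B x d fl lam :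
  0 < s -> 0 < rho -> rho < 1 -> 0 <= sigma -> 0 < Acap <= 1 -> 0 < a ->
  0 <= theta -> 0 <= zeta -> B^T = B -> gradient f x <> 0 ->
  search_direction f alpha Acap theta a zeta B x d fl ->
  step_size f s rho sigma B x d fl lam ->
  f (x + lam *: d) <= f x.
Proof.
move=> s0 rho0 rho1 sigma0 /andP[A0 A1] a0 theta0 zeta0 symB g0 dir step.
have [lam0 dec _] := step_sizeP s0 rho0 rho1 step.
suff [q0 gd] : linesearch_curvature B d fl <= 0 /\ 0 <= - dot (gradient f x) d.
  have := sufficient_decrease_le sigma0 (lexx 0) (ltW lam0) q0 (lexx 0) gd dec.
  by rewrite mul0r mulr0 subr0.
have [flE|flN] := pselect (fl = NPC).
  move: dir; rewrite flE /= => dir.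
  have [_ curv le_gd] := direction_npc symB theta0 g0 dir; split.
    by apply: le_trans curv _; rewrite oppr_le0 mulr_ge0 ?sqr_ge0.
  by apply: le_trans le_gd; rewrite mulr_ge0 ?sqr_ge0// le_min ler01.
split; first by case: fl flN {dir step dec}.
have [M M1 BM] := matrix_bounded (B + zeta%:M).
have c0 : 0 < Num.min Acap (a * enorm (gradient f x) `^ alpha).
  by rewrite lt_min A0 mulr_gt0// powR_gt0 ?enorm_gt0.
have [+ _] := direction_descent symB A1 M1 c0 (lexx _) BM dir flN.
by apply: le_trans; rewrite mulr_ge0 ?sqr_ge0 ?ltW.
Qed.

Lemma near_enorm_gradient f (xstar : 'cV[R]_n) :
  twice_continuously_differentiable f ->
  \forall x \near xstar, enorm (gradient f x) <= enorm (gradient f xstar) + 1.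
Proof.
move=> /gradient_continuous /(_ xstar) gc.
have lt1 : enorm (gradient f xstar) < enorm (gradient f xstar) + 1.
  by rewrite ltrDl.
by apply: filterS (cvgr_lt _ gc _ lt1) => x; exact: ltW.
Qed.

(** The slope - c |d|^2 dominates every second-order term: those of f and of
    the condition add up to at most t^2 (H + 1 + M) |d|^2 / 2, with H a bound
    for the Hessian and 1 the Taylor error, while the condition leaves
    (1 - sigma) t c |d|^2 to absorb them. *)
Lemma first_order_decrease f (xstar : 'cV[R]_n) sigma c M D :
  twice_continuously_differentiable f ->
  0 < sigma -> sigma < 1 -> 0 < c -> 0 < M -> 0 < D ->
  exists2 t0, 0 < t0 & \forall x \near xstar, forall d q t, enorm d <= D ->
    c * enorm d ^+ 2 <= - dot (gradient f x) d ->
    - (M * enorm d ^+ 2) <= q -> 0 < t <= t0 ->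
    sufficient_decrease f sigma x d q t.
Proof.
move=> fC2 sigma0 sigma1 c0 M0 D0.
have [delta delta0 taylor] := local_second_order_bound xstar fC2 ltr01.
have [H H0 hessH] := hessian_locally_bounded xstar fC2.
pose L := H + 1 + M; have L0 : 0 < L by rewrite !addr_gt0.
exists (Num.min (delta / (2 * D)) ((1 - sigma) * c / L)).
  by rewrite lt_min !divr_gt0 ?mulr_gt0 ?subr_gt0.
apply: filterS2 taylor hessH => x taylor hessH d q t dD gd qM.
rewrite le_min => /andP[t0 /andP[tdelta tL]].
have small : enorm (t *: d) < delta.
  rewrite enormZ gtr0_norm//; apply: (@le_lt_trans _ _ (t * D)).
    by rewrite ler_wpM2l// ltW.
  apply: (@le_lt_trans _ _ (delta / 2)); last by lra.
  move: tdelta; rewrite invfM mulrA ler_pdivlMr//.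
have := taylor _ small.
rewrite /sufficient_decrease enormZ gtr0_norm// -scalemxAr !dotZr dotZl exprMn.
have dHd : dot d (hessian f x *m d) <= H * enorm d ^+ 2.
  apply: le_trans (dot_le _ _) _; rewrite expr2 mulrCA.
  by rewrite ler_wpM2l ?enorm_ge0.
have tLc : t * L <= (1 - sigma) * c by rewrite -ler_pdivlMr.
set N := enorm d ^+ 2 in gd qM dHd *; have N0 : 0 <= N by exact: sqr_ge0.
move: (dot _ d) (dot d _) (f _) (f _) gd dHd => g h F F' gd dHd hF.
have tq : - (t ^+ 2 * (M * N)) <= t ^+ 2 * q.
  by rewrite -mulrN ler_wpM2l ?sqr_ge0.
have tH : t ^+ 2 * h <= t ^+ 2 * (H * N) by rewrite ler_wpM2l ?sqr_ge0.
have tLN : t * (t * L * N) <= t * ((1 - sigma) * c * N).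
  by rewrite ler_wpM2l ?(ltW t0)// ler_wpM2r.
have tg : t * (1 - sigma) * (c * N) <= t * (1 - sigma) * - g.
  by rewrite ler_wpM2l// mulr_ge0 ?(ltW t0)// subr_ge0 ltW.
have sq : - (sigma * (t ^+ 2 * (M * N))) <= sigma * (t ^+ 2 * q).
  by rewrite -mulrN ler_wpM2l// ltW.
have MN : sigma * (t ^+ 2 * (M * N)) <= t ^+ 2 * (M * N).
  by rewrite ler_piMl ?(ltW sigma1)// mulr_ge0 ?sqr_ge0// mulr_ge0// ltW.
have tcN : 0 <= t * (1 - sigma) * (c * N).
  by apply: mulr_ge0; apply: mulr_ge0; rewrite ?subr_ge0// ltW.
rewrite /L in tLN; lra.
Qed.

(** When B is the Hessian, the second-order terms of f and of the condition
    are the same, and a Taylor error of (1 - sigma) zeta |d|^2 t^2 / 2 is paid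
    for by the fraction 1 - sigma of the negative curvature. *)
Lemma curvature_decrease f (xstar : 'cV[R]_n) sigma zeta D :
  twice_continuously_differentiable f ->
  0 < sigma -> sigma < 1 -> 0 < zeta -> 0 < D ->
  exists2 t0, 0 < t0 & \forall x \near xstar, forall d t, enorm d <= D ->
    dot (gradient f x) d <= 0 ->
    dot d (hessian f x *m d) <= - (zeta * enorm d ^+ 2) -> 0 < t <= t0 ->
    sufficient_decrease f sigma x d (dot d (hessian f x *m d)) t.
Proof.
move=> fC2 sigma0 sigma1 zeta0 D0.
have kappa0 : 0 < (1 - sigma) * zeta by rewrite mulr_gt0 ?subr_gt0.
have [delta delta0 taylor] := local_second_order_bound xstar fC2 kappa0.
exists (delta / (2 * D)); first by rewrite divr_gt0 ?mulr_gt0.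
apply: filterS taylor => x taylor d t dD gd curv /andP[t0 tdelta].
have small : enorm (t *: d) < delta.
  rewrite enormZ gtr0_norm//; apply: (@le_lt_trans _ _ (t * D)).
    by rewrite ler_wpM2l// ltW.
  apply: (@le_lt_trans _ _ (delta / 2)); last by lra.
  move: tdelta; rewrite invfM mulrA ler_pdivlMr//.
have := taylor _ small.
rewrite /sufficient_decrease enormZ gtr0_norm// -scalemxAr !dotZr dotZl exprMn.
set N := enorm d ^+ 2 in curv *.
move: (dot (gradient f x) d) (dot d _) (f _) (f _) gd curv.
move=> g h F F' gd curv hF.
have tg : t * (1 - sigma) * g <= 0.
  by rewrite mulr_ge0_le0// mulr_ge0 ?(ltW t0)// subr_ge0 ltW.
have th : t ^+ 2 * (1 - sigma) * h <= t ^+ 2 * (1 - sigma) * - (zeta * N).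
  by rewrite ler_wpM2l// mulr_ge0 ?sqr_ge0// subr_ge0 ltW.
lra.
Qed.

End Progress.

(** * Uniform decrease near a nonstationary point *)

Section UniformProgress.
Context {R : realType} {n : nat}.
Variables (f : 'cV[R]_n -> R) (xstar : 'cV[R]_n).
Variables (s rho sigma alpha Acap : R).
Hypotheses (fC2 : twice_continuously_differentiable f) (s_gt0 : 0 < s).
Hypotheses (rho_gt0 : 0 < rho) (rho_lt1 : rho < 1).
Hypotheses (sigma_gt0 : 0 < sigma) (sigma_lt1 : sigma < 1).
Implicit Types (x d : 'cV[R]_n) (B : 'M[R]_n).

(** The constants depend on B, a and zeta only through c and M.  The bound
    c |d|^2 <= - g . d <= |g| |d| limits |d|, so that the Taylor bound applies
    to all short steps. *)
Lemma descent_progress c M eps :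
  Acap <= 1 -> 0 < c -> 1 <= M -> 0 < eps ->
  exists2 eta, 0 < eta & \forall x \near xstar,
    forall theta a zeta B d fl lam, B^T = B ->
      eps <= enorm (gradient f x) ->
      c <= Num.min Acap (a * enorm (gradient f x) `^ alpha) ->
      (forall u, enorm ((B + zeta%:M) *m u) <= M * enorm u) ->
      search_direction f alpha Acap theta a zeta B x d fl -> fl <> NPC ->
      step_size f s rho sigma B x d fl lam ->
      f (x + lam *: d) <= f x - eta.
Proof.
move=> A1 c0 M1 eps0; set G := enorm (gradient f xstar) + 1.
have G0 : 0 < G by rewrite ltr_pwDr// enorm_ge0.
have M0 : 0 < M by apply: lt_le_trans M1.
have [t0 t0_gt0 dec] := first_order_decrease xstar fC2 sigma_gt0 sigma_lt1 c0
  ltr01 (divr_gt0 G0 c0).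
pose e := c ^+ 3 / (M ^+ 2 * (M ^+ 2 + c ^+ 2)).
have e0 : 0 < e.
  by rewrite divr_gt0 ?mulr_gt0 ?addr_gt0 ?exprn_gt0.
have lam1_gt0 : 0 < Num.min s (rho * t0) by rewrite lt_min s_gt0 mulr_gt0.
exists (sigma * (Num.min s (rho * t0) * (e * eps ^+ 2))).
  apply: mulr_gt0 => //; apply: mulr_gt0 => //; apply: mulr_gt0 => //.
  exact: exprn_gt0.
apply: filterS2 (near_enorm_gradient xstar fC2) dec => x gG dec.
move=> theta a zeta B d fl lam symB geps cle BM dir flN step.
have [cd ed] := direction_descent symB A1 M1 c0 cle BM dir flN.
have [lam0 suff low] := step_sizeP s_gt0 rho_gt0 rho_lt1 step.
have q0 : linesearch_curvature B d fl = 0 by case: fl flN {dir step suff low}.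
rewrite q0 in suff low.
have dD : enorm d <= G / c.
  rewrite ler_pdivlMr//; apply: le_trans gG.
  have [->|/eqP/enorm_gt0 dn0] := eqVneq d 0.
    by rewrite /enorm dot0l sqrtr0 mul0r sqrtr_ge0.
  rewrite -(ler_pM2r dn0); apply: (@le_trans _ _ (c * enorm d ^+ 2)).
    by rewrite mulrAC mulrC expr2.
  by apply: le_trans cd _; rewrite -dotNl -(enormN (gradient f x)) dot_le.
apply: (sufficient_decrease_le (ltW sigma_gt0) (ltW lam1_gt0)) suff => //.
- apply: low => t t_small; apply: dec => //.
  by rewrite oppr_le0 mulr_ge0 ?sqr_ge0.
- by rewrite mulr_ge0 ?sqr_ge0 ?(ltW e0).
apply: le_trans ed; rewrite ler_wpM2l ?(ltW e0)//.
by rewrite ler_pXn2r ?nnegrE ?enorm_ge0// ltW.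
Qed.

(** As |d| = |g|, the slope bound theta0 |g|^2 <= - g . d reads
    theta0 |d|^2 <= - g . d, the hypothesis of [first_order_decrease]. *)
Lemma npc_progress_tolerance theta0 M eps :
  0 < theta0 -> 0 < M -> 0 < eps ->
  exists2 eta, 0 < eta & \forall x \near xstar,
    forall theta a zeta B d lam, B^T = B -> 0 <= theta -> 0 <= zeta ->
      eps <= enorm (gradient f x) -> theta0 <= Num.min 1 theta ->
      (forall u, enorm (B *m u) <= M * enorm u) ->
      search_direction f alpha Acap theta a zeta B x d NPC ->
      step_size f s rho sigma B x d NPC lam ->
      f (x + lam *: d) <= f x - eta.
Proof.
move=> th0 M0 eps0; set G := enorm (gradient f xstar) + 1.
have G0 : 0 < G by rewrite ltr_pwDr// enorm_ge0.
have [t0 t0_gt0 dec] :=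
  first_order_decrease xstar fC2 sigma_gt0 sigma_lt1 th0 M0 G0.
have lam1_gt0 : 0 < Num.min s (rho * t0) by rewrite lt_min s_gt0 mulr_gt0.
exists (sigma * (Num.min s (rho * t0) * (theta0 * eps ^+ 2))).
  apply: mulr_gt0 => //; apply: mulr_gt0 => //; apply: mulr_gt0 => //.
  exact: exprn_gt0.
apply: filterS2 (near_enorm_gradient xstar fC2) dec => x gG dec.
move=> theta a zeta B d lam symB theta_ge0 zeta0 geps thle BM dir step.
have gn0 : gradient f x <> 0.
  by move=> g0; move: geps; rewrite leNgt g0 /enorm dot0l sqrtr0 eps0.
have [dn curv gd] := direction_npc symB theta_ge0 gn0 dir.
have [lam0 suff low] := step_sizeP s_gt0 rho_gt0 rho_lt1 step.
have thgd : theta0 * enorm (gradient f x) ^+ 2 <= - dot (gradient f x) d.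
  by apply: le_trans gd; rewrite ler_wpM2r ?sqr_ge0.
apply: (sufficient_decrease_le (ltW sigma_gt0) (ltW lam1_gt0)) suff => //.
- apply: low => t t_small; apply: dec => //.
  + by rewrite dn.
  + by rewrite dn.
  rewrite /= lerNl -dotNr; apply: le_trans (dot_le _ _) _.
  by rewrite enormN expr2 mulrCA ler_wpM2l ?enorm_ge0.
- by apply: le_trans curv _; rewrite oppr_le0 mulr_ge0 ?sqr_ge0.
- by rewrite mulr_ge0 ?sqr_ge0 ?(ltW th0).
apply: le_trans thgd; rewrite ler_wpM2l ?(ltW th0)//.
by rewrite ler_pXn2r ?nnegrE ?enorm_ge0// ltW.
Qed.

(** The slope may vanish in the limit; the decrease is the curvature term
    sigma t^2 / 2 (d . B d), with |d| = |g| bounded away from zero. *)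
Lemma npc_progress_hessian zeta0 eps :
  0 < zeta0 -> 0 < eps ->
  exists2 eta, 0 < eta & \forall x \near xstar,
    forall theta a zeta B d lam, B^T = B -> 0 <= theta -> zeta0 <= zeta ->
      eps <= enorm (gradient f x) -> B = hessian f x ->
      search_direction f alpha Acap theta a zeta B x d NPC ->
      step_size f s rho sigma B x d NPC lam ->
      f (x + lam *: d) <= f x - eta.
Proof.
move=> z0 eps0; set G := enorm (gradient f xstar) + 1.
have G0 : 0 < G by rewrite ltr_pwDr// enorm_ge0.
have [t0 t0_gt0 dec] :=
  curvature_decrease xstar fC2 sigma_gt0 sigma_lt1 z0 G0.
set lam1 := Num.min s (rho * t0).
have lam1_gt0 : 0 < lam1 by rewrite lt_min s_gt0 mulr_gt0.
exists (sigma * (lam1 ^+ 2 / 2 * (zeta0 * eps ^+ 2))).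
  by rewrite !mulr_gt0// ?divr_gt0 ?exprn_gt0.
apply: filterS2 (near_enorm_gradient xstar fC2) dec => x gG dec.
move=> theta a zeta B d lam symB theta_ge0 zle geps BH dir step.
have gn0 : gradient f x <> 0.
  by move=> g0; move: geps; rewrite leNgt g0 /enorm dot0l sqrtr0 eps0.
have [dn curv gd] := direction_npc symB theta_ge0 gn0 dir.
have [lam0 suff low] := step_sizeP s_gt0 rho_gt0 rho_lt1 step.
have {}gd : dot (gradient f x) d <= 0.
  rewrite -oppr_ge0; apply: le_trans gd.
  by rewrite mulr_ge0 ?sqr_ge0// le_min ler01.
have {}curv : dot d (B *m d) <= - (zeta0 * enorm d ^+ 2).
  by apply: le_trans curv _; rewrite lerN2 ler_wpM2r ?sqr_ge0.
have lam1_le : lam1 <= lam.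
  by apply: low => t t_small; rewrite /= BH; apply: dec; rewrite -?BH// dn.
move: suff; rewrite /sufficient_decrease /= lerBlDr => /le_trans; apply.
rewrite [leLHS]addrC lerD2l -mulrN ler_wpM2l ?(ltW sigma_gt0)//.
have : lam * dot (gradient f x) d <= 0 by rewrite mulr_ge0_le0// ltW.
have : lam1 ^+ 2 / 2 * (zeta0 * eps ^+ 2) <= lam ^+ 2 / 2 * - dot d (B *m d).
  apply: ler_pM.
  - by rewrite divr_ge0 ?sqr_ge0.
  - by rewrite mulr_ge0 ?sqr_ge0 ?(ltW z0).
  - by rewrite ler_pM2r ?invr_gt0// ler_pXn2r// nnegrE ltW.
  rewrite lerNr; apply: le_trans curv _; rewrite lerN2 ler_wpM2l ?(ltW z0)// dn.
  by rewrite ler_pXn2r ?nnegrE ?enorm_ge0// ltW.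
by lra.
Qed.

End UniformProgress.

Lemma cluster_progress_contradiction {R : realType} {T : topologicalType}
    (f : T -> R) (x : nat -> T) (xstar : T) (eta : R) :
  {for xstar, continuous f} -> (forall k, f (x k.+1) <= f (x k)) -> 0 < eta ->
  (\forall y \near xstar, forall k, x k = y -> f (x k.+1) <= f (x k) - eta) ->
  ~ cluster (x @ \oo) xstar.
Proof.
move=> fcont fdec eta0 progress clus.
have anti : forall i j, (i <= j)%N -> f (x j) <= f (x i).
  move=> i j /subnK <-; elim: (j - i)%N => [|m]; first by rewrite add0n.
  by rewrite addSn; apply: le_trans.
have visit (P : T -> Prop) N : (\forall y \near xstar, P y) ->
    exists2 k, (N <= k)%N & P (x k).
  move=> nearP.
  have tailN : (x @ \oo) [set y | exists2 k, (N <= k)%N & x k = y].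
    by exists N => // k /= Nk; exists k.
  by have [y [[k Nk <-] Pk]] := clus _ _ tailN nearP; exists k.
have lt_star : f xstar < f xstar + eta / 2 by rewrite ltrDl divr_gt0.
have star_gt : f xstar - eta / 2 < f xstar by rewrite gtrBl divr_gt0.
have near_lt : \forall y \near xstar, f y < f xstar + eta / 2.
  exact: cvgr_lt _ fcont _ lt_star.
have near_gt : \forall y \near xstar, f xstar - eta / 2 < f y.
  exact: cvgr_gt _ fcont _ star_gt.
have [k _ [fk progk]] := visit _ 0%N (filterI near_lt progress).
have [l kl fl] := visit _ k.+1 near_gt.
have := anti _ _ kl; have := progk k erefl; rewrite /= in fk fl; lra.
Qed.

(** * Convergence *)

(** Turns the lower bounds on a_k, b_k, z_k and on the gradient norm into
    lower bounds for the thresholds, tolerances and shifts of the method. *)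
Lemma le_min_powR {R : realType} (cap lo b eps t r : R) :
  0 < lo -> lo <= b -> 0 < eps -> eps <= t -> 0 <= r ->
  Num.min cap (lo * eps `^ r) <= Num.min cap (b * t `^ r).
Proof.
move=> lo0 lob eps0 epst r0; rewrite le_min !ge_min lexx/=; apply/orP; right.
apply: ler_pM; rewrite ?powR_ge0 ?(ltW lo0)//.
by apply: ge0_ler_powR; rewrite ?nnegrE ?(ltW eps0)// (le_trans (ltW eps0)).
Qed.

Lemma min_powR_gt0 {R : realType} (cap lo eps r : R) :
  0 < cap -> 0 < lo -> 0 < eps -> 0 < Num.min cap (lo * eps `^ r).
Proof. by move=> cap0 lo0 eps0; rewrite lt_min cap0 mulr_gt0 ?powR_gt0. Qed.

Theorem theorem3p6 (R : realType) (n : nat) (f : 'cV[R]_n -> R)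
    (rho sigma alpha Acap s abar : R)
    (theta a zeta : nat -> R) (B : nat -> 'M[R]_n) (x : nat -> 'cV[R]_n)
    (Z zexp zbar : R) (z : nat -> R)
    (f_C2 : twice_continuously_differentiable f)
    (rho_bounds : 0 < rho < 1) (sigma_bounds : 0 < sigma < 1)
    (alpha_bounds : 0 < alpha <= 1) (Acap_bounds : 0 < Acap <= 1)
    (s_gt0 : 0 < s)
    (theta_ge0 : forall k, 0 <= theta k)
    (abar_gt0 : 0 < abar) (a_ge : forall k, abar <= a k)
    (zeta_ge0 : forall k, 0 <= zeta k)
    (B_sym : forall k, (B k)^T = B k)
    (x_generated :
      minres_linesearch f rho sigma alpha Acap s theta a zeta B x)
    (Z_gt0 : 0 < Z) (zexp_bounds : 0 < zexp <= 1)
    (zbar_gt0 : 0 < zbar) (z_ge : forall k, zbar <= z k)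
    (zetaE : forall k,
      zeta k = Num.min Z (z k * enorm (gradient f (x k)) `^ zexp))
    (cases :
      ((exists M : R, 0 < M /\ forall k, spectral_norm (B k) <= M) /\
       (exists (Bcap beta bbar : R) (b : nat -> R),
          [/\ 0 < Bcap, 0 < beta, 0 < bbar, forall k, bbar <= b k
            & forall k, theta k =
                Num.min Bcap (b k * enorm (gradient f (x k)) `^ beta)]))
      \/ (forall k, B k = hessian f (x k))) :
  forall xstar : 'cV[R]_n, cluster (x @ \oo) xstar -> gradient f xstar = 0.
Proof.
move=> xstar clus; apply: contrapT => gstar0.
case/andP: rho_bounds sigma_bounds => rho0 rho1 /andP[sigma0 sigma1].
have /andP[A0 A1] := Acap_bounds; have /andP[/ltW alpha0 _] := alpha_bounds.
have /andP[/ltW zexp0 _] := zexp_bounds.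
pose eps := enorm (gradient f xstar) / 2.
have eps0 : 0 < eps by rewrite divr_gt0 ?enorm_gt0.
have near_eps : \forall y \near xstar, eps <= enorm (gradient f y).
  have lt_star : eps < enorm (gradient f xstar).
    by rewrite ltr_pdivrMr// mulr_natr mulr2n ltrDl enorm_gt0.
  have /(_ xstar) gc := gradient_continuous f_C2.
  by apply: filterS (cvgr_gt _ gc _ lt_star) => y; exact: ltW.
have [M M1 near_M] : exists2 M, 1 <= M & \forall y \near xstar,
    forall k, x k = y -> forall u, enorm (B k *m u) <= M * enorm u.
  case: cases => [[[M [_ BM]] _]|BH].
    exists (Num.max 1 M); first by rewrite le_max lexx.
    apply: (@nearW _ (nbhs xstar)) => y k _ u; apply: spectral_norm_le.
    by rewrite le_max BM orbT.
  have [M M0 hessM] := hessian_locally_bounded xstar f_C2.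
  exists (Num.max 1 M); first by rewrite le_max lexx.
  apply: filterS hessM => y hessM k xk u; rewrite BH xk.
  apply: le_trans (hessM u) _.
  by rewrite ler_wpM2r ?enorm_ge0// le_max lexx orbT.
have M0 : 0 < M by apply: lt_le_trans M1.
have MZ1 : 1 <= M + Z by rewrite ler_wpDr// ltW.
pose c := Num.min Acap (abar * eps `^ alpha).
have c0 : 0 < c by apply: min_powR_gt0.
have [eta1 eta1_gt0 progress1] := descent_progress xstar alpha f_C2 s_gt0
  rho0 rho1 sigma0 sigma1 A1 c0 MZ1 eps0.
have [eta2 eta2_gt0 progress2] : exists2 eta, 0 < eta & \forall y \near xstar,
    forall k d lam, x k = y ->
      search_direction f alpha Acap (theta k) (a k) (zeta k) (B k) (x k) d
        NPC ->
      step_size f s rho sigma (B k) (x k) d NPC lam ->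
      f (x k + lam *: d) <= f (x k) - eta.
  case: cases => [[_ [Bcap [beta [bbar [b []]]]]]|BH].
    move=> Bcap0 beta0 bbar0 b_ge thetaE.
    pose theta0 := Num.min 1 (Num.min Bcap (bbar * eps `^ beta)).
    have theta0_gt0 : 0 < theta0 by rewrite lt_min ltr01 min_powR_gt0.
    have [eta eta0 progress] := npc_progress_tolerance xstar alpha Acap f_C2
      s_gt0 rho0 rho1 sigma0 sigma1 theta0_gt0 M0 eps0.
    exists eta => //; apply: filterS3 near_eps near_M progress.
    move=> y geps BM progress k d lam xk; rewrite xk; apply: progress => //.
      rewrite le_min ge_min lexx/= ge_min thetaE xk; apply/orP; right.
      by apply: le_min_powR => //; exact: ltW.
    exact: BM.
  pose zeta0 := Num.min Z (zbar * eps `^ zexp).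
  have zeta0_gt0 : 0 < zeta0 by apply: min_powR_gt0.
  have [eta eta0 progress] := npc_progress_hessian xstar alpha Acap f_C2
    s_gt0 rho0 rho1 sigma0 sigma1 zeta0_gt0 eps0.
  exists eta => //; apply: filterS2 near_eps progress.
  move=> y geps progress k d lam xk; rewrite xk => dir step.
  apply: progress dir step; [exact: B_sym|exact: theta_ge0| |exact: geps|].
    by rewrite zetaE xk; apply: le_min_powR.
  by rewrite BH xk.
have eta_gt0 : 0 < Num.min eta1 eta2 by rewrite lt_min eta1_gt0.
apply: (cluster_progress_contradiction _ _ eta_gt0 _ clus).
- by have [df _ _] := f_C2; exact: differentiable_continuous.
- move=> k; have [stop go] := x_generated k.
  have [g0|/eqP gk0] := eqVneq (gradient f (x k)) 0; first by rewrite stop.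
  have [d [fl [lam [dir step ->]]]] := go gk0.
  apply: step_nonincreasing dir step => //; first exact: ltW.
  exact: lt_le_trans (a_ge k).
apply: filterS2 (filterI near_eps near_M) (filterI progress1 progress2).
move=> y [geps BM] [prog1 prog2] k xk.
have [_ go] := x_generated k.
have gk0 : gradient f (x k) <> 0.
  by move=> g0; move: geps; rewrite -xk g0 leNgt /enorm dot0l sqrtr0 eps0.
have [d [fl [lam [dir step ->]]]] := go gk0.
have [flE|flN] := pselect (fl = NPC).
  rewrite flE in dir step; apply: le_trans (prog2 k d lam xk dir step) _.
  by rewrite lerD2l lerN2 ge_min lexx orbT.
apply: (@le_trans _ _ (f (x k) - eta1)); last first.
  by rewrite lerD2l lerN2 ge_min lexx.
rewrite xk in dir step *; apply: prog1 dir flN step => //.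
  exact: le_min_powR.
move=> u; apply: le_trans (enorm_mulmxD_scalar u (zeta_ge0 k) (BM k xk)) _.
by rewrite ler_wpM2r ?enorm_ge0// lerD2l zetaE ge_min lexx.
Qed.
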